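(* If $\Lambda_1,\Lambda_2\subset\mathbb{R}$ are type 1 sets, then $\Lambda_1\cup\Lambda_2$ is also type 1.
   Context: A set $\Lambda\subset\mathbb{R}$ is called admissible if it is countably infinite, unbounded, bounded from below, and has no finite accumulation points; type 1 and type 2 sets are by definition admissible. Let $\mu$ denote Lebesgue measure on $\mathbb{R}$. For an admissible $\Lambda$ and a (Lebesgue) measurable $f:\mathbb{R}\to[0,+\infty)$, put $s(x)=\sum_{\lambda\in\Lambda}f(x+\lambda)$, $C(f,\Lambda)=\{x\in\mathbb{R}: s(x)<\infty\}$ and $D(f,\Lambda)=\{x\in\mathbb{R}: s(x)=\infty\}$. The set $\Lambda$ is type 1 if for every measurable $f:\mathbb{R}\to[0,+\infty)$ either $\mu(D(f,\Lambda))=0$ or $\mu(C(f,\Lambda))=0$. Otherwise $\Lambda$ is type 2. *)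

(* Defs.v *)
From mathcomp Require Import all_boot all_order all_algebra.
From mathcomp Require Import all_classical all_reals all_analysis.

Set Implicit Arguments.
Unset Strict Implicit.
Unset Printing Implicit Defensive.

Import Order.TTheory GRing.Theory Num.Theory.
Import numFieldNormedType.Exports.

Local Open Scope classical_set_scope.
Local Open Scope ring_scope.

(* The carrier [R] with the sigma-algebra of Lebesgue measurable sets, i.e. the
   domain of [completed_lebesgue_measure] (by contrast, the canonical
   sigma-algebra of [measurableTypeR R] consists of the Borel sets only). *)
Notation lebesgueType R := (caratheodory_type ((@wlength R idfun)^*)%mu).

(* Lebesgue measurable preimages of Borel sets. *)
Definition lebesgue_measurable_fun (R : realType) (f : R -> R) : Prop :=
  measurable_fun [set: lebesgueType R]
    (f : lebesgueType R -> measurableTypeR R).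

Section translated_sums.
Context {R : realType}.
Implicit Types (L : set R) (f : R -> R).

Definition admissible L : Prop :=
  [/\ countable L, infinite_set L, ~ bounded_set L, has_lbound L
    & limit_point L = set0].

Definition translate_sum f L (x : R) : \bar R := \esum_(l in L) (f (x + l))%:E.

Definition conv_set f L : set R := [set x | (translate_sum f L x < +oo)%E].

Definition div_set f L : set R := [set x | translate_sum f L x = +oo%E].

Definition type1 L : Prop :=
  admissible L /\
  forall f, (forall x, 0 <= f x) -> lebesgue_measurable_fun f ->
    completed_lebesgue_measure (div_set f L) = 0%E \/
    completed_lebesgue_measure (conv_set f L) = 0%E.

End translated_sums.

(* Main.v *)
Require Import Defs.
From mathcomp Require Import all_boot all_order all_algebra.
From mathcomp Require Import all_classical all_reals all_analysis.

Import Order.TTheory GRing.Theory Num.Theory.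

Local Open Scope classical_set_scope.

(** Fix a nonnegative measurable [f], and write [Ci], [Di] for the convergence
    and divergence sets of the sum over [Li], and [C], [D] for those of the sum
    over [L1 `|` L2]. A sum of nonnegative terms over a union dominates the sum
    over each part and is dominated by the total of the two, so [C] is contained
    in [C1] and in [C2] ([conv_set_antitone]), while [D] is contained in
    [D1 `|` D2] ([div_setU_subset]). If [C1] or [C2] is null, then so is [C].
    Otherwise, [L1] and [L2] being of type 1, both [D1] and [D2] are null, hence
    so is [D]. That the union is again admissible is elementary; the
    accumulation points are handled by [limit_pointU]. *)

(** * Admissibility of a union *)

(** Two neighbourhoods witnessing that [p] is a limit point of neither set can
    be intersected into one that witnesses the same for the union. *)
Lemma limit_pointU (T : topologicalType) (A B : set T) :
  limit_point (A `|` B) = limit_point A `|` limit_point B.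
Proof.
apply/seteqP; split=> [p ABp|p [] lp U /lp[y [yp Ey Uy]]]; last 2 first.
- by exists y; split=> //; left.
- by exists y; split=> //; right.
apply: contrapT => /not_orP[].
rewrite !not_limit_pointE => -[U pU AUp] [V pV BVp].
have [y [/eqP yp [Ay|By] [Uy Vy]]] := ABp _ (filterI pU pV).
- exact/yp/AUp.
- exact/yp/BVp.
Qed.

Lemma has_lboundU (R : realType) (A B : set R) :
  has_lbound A -> has_lbound B -> has_lbound (A `|` B).
Proof.
move=> [a Aa] [b Bb]; exists (Order.min a b) => x [Ax|Bx].
- by rewrite ge_min Aa.
- by rewrite ge_min Bb// orbT.
Qed.

Lemma admissibleU (R : realType) (A B : set R) :
  admissible A -> admissible B -> admissible (A `|` B).
Proof.
move=> [cA iA uA lA pA] [cB _ _ lB pB]; split.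
- rewrite -bigcup2E; apply: bigcup_countable => // -[|[|n]] _ //=.
- by move=> /(sub_finite_set (@subsetUl _ A B)).
- by move=> bAB; apply: uA; apply: sub_boundedr bAB => P ABP x Ax; apply: ABP; left.
- exact: has_lboundU.
- by rewrite limit_pointU pA pB setU0.
Qed.

(** * Sums over a union *)

Lemma esum_monotone (R : realType) (T : choiceType) (a : T -> \bar R)
    (A B : set T) : A `<=` B ->
  (esum A a <= esum B a)%E.
Proof.
move=> AB; apply: ereal_sup_le => _ [F [finF FA] <-].
by exists F => //; split=> //; exact: subset_trans AB.
Qed.

Lemma conv_set_antitone (R : realType) (f : R -> R) (A B : set R) :
  A `<=` B -> conv_set f B `<=` conv_set f A.
Proof. by move=> AB x; apply: le_lt_trans; exact: esum_monotone. Qed.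

Lemma translate_sumU_le (R : realType) (f : R -> R) (A B : set R) (x : R) :
  (forall y, (0 <= f y)%R) ->
  (translate_sum f (A `|` B) x <= translate_sum f A x + translate_sum f B x)%E.
Proof.
move=> f0; rewrite /translate_sum (esumID A) => [|l _]; last by rewrite lee_fin.
by apply: leeD; apply: esum_monotone => l [] // [].
Qed.

Lemma div_setU_subset (R : realType) (f : R -> R) (A B : set R) :
  (forall y, (0 <= f y)%R) ->
  div_set f (A `|` B) `<=` div_set f A `|` div_set f B.
Proof.
move=> f0 x Dx; apply: contrapT => /not_orP[/eqP nA /eqP nB].
have := translate_sumU_le R f A B x f0; rewrite [X in (X <= _)%E]Dx leNgt.
by rewrite lte_add_pinfty // ltey.
Qed.

(** * Null sets *)

(** As a function on sets, [completed_lebesgue_measure] is the outer measure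
    induced by interval length, so it is monotone and subadditive on arbitrary
    subsets of [R]. *)
Lemma completed_lebesgue_measure_subset0 (R : realType) (A B : set R) :
  A `<=` B -> completed_lebesgue_measure B = 0%E ->
  completed_lebesgue_measure A = 0%E.
Proof.
move=> AB B0; apply/eqP; rewrite eq_le; apply/andP; split.
- by rewrite -B0; exact: (le_outer_measure ((@wlength R idfun)^*)%mu).
- exact: (outer_measure_ge0 ((@wlength R idfun)^*)%mu).
Qed.

Lemma completed_lebesgue_measureU0 (R : realType) (A B : set R) :
  completed_lebesgue_measure A = 0%E -> completed_lebesgue_measure B = 0%E ->
  completed_lebesgue_measure (A `|` B) = 0%E.
Proof.
move=> A0 B0; apply/eqP; rewrite eq_le; apply/andP; split.
- rewrite -[leRHS]adde0 -{1}A0 -B0.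
  exact: (outer_measureU2 ((@wlength R idfun)^*)%mu).
- exact: (outer_measure_ge0 ((@wlength R idfun)^*)%mu).
Qed.

(** * Unions of type 1 sets *)

Theorem proposition4p1 (R : realType) (L1 L2 : set R)
    (hL1 : type1 L1) (hL2 : type1 L2) : type1 (L1 `|` L2).
Proof.
have [[aL1 tL1] [aL2 tL2]] := (hL1, hL2).
split=> [|f f0 mf]; first exact: admissibleU.
have [D1|C1] := tL1 f f0 mf; last first.
  right; apply: completed_lebesgue_measure_subset0 C1.
  exact/conv_set_antitone/subsetUl.
have [D2|C2] := tL2 f f0 mf; last first.
  right; apply: completed_lebesgue_measure_subset0 C2.
  exact/conv_set_antitone/subsetUr.
left; apply: completed_lebesgue_measure_subset0 (div_setU_subset _ _ _ _ f0) _.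
exact: completed_lebesgue_measureU0.
Qed.
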